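(* For every $\varepsilon>0$ there exist $\eta>0$ and $C>0$ such that the following holds. Let $\mathbf{G}$ be a finite abelian group, let $A\subseteq \mathbf{G}$ with $|A|=\delta|\mathbf{G}|$ and $|A-A|=K|A|$. If $|A|\geqslant C$, $\log^2 K\leqslant \eta \log|A|$ and $K^2\delta\leqslant \eta$, then $$M^2(A)\,\rho(A)\geqslant (1-\varepsilon)\,\frac{|A|^3}{K}.$$ (Equivalently, in asymptotic form: if $|A|\to\infty$, $\log^2 K=o(\log|A|)$ and $K^2\delta=o(1)$, then $M^2(A)\rho(A)\geqslant \frac{|A|^3}{K}(1-o(1))$.)
   Context: $\widehat{\mathbf{G}}$ denotes the dual group of $\mathbf{G}$. For $f:\mathbf{G}\to\mathbb{C}$ and $\xi\in\widehat{\mathbf{G}}$, $\widehat f(\xi)=\sum_{g\in\mathbf{G}} f(g)\overline{\xi(g)}$. A set $A$ is identified with its indicator function, so $\widehat{A}(\xi)=\sum_{a\in A}\overline{\xi(a)}$. $A-A=\{a-b: a,b\in A\}$. Define $\rho(A)=\max_{x\neq 0}|A\cap(A+x)|$ and $M(A)=\max_{\xi\neq 0}|\widehat{A}(\xi)|$, where $\xi\neq 0$ means $\xi$ ranges over nontrivial characters. Logarithms are natural. *)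

(* Defs.v *)
From HB Require Import structures.
From mathcomp Require Import all_boot all_order all_algebra.
From mathcomp Require Import complex.
From mathcomp Require Import boolp classical_sets reals exp.

Set Implicit Arguments.
Unset Strict Implicit.
Unset Printing Implicit Defensive.

Import Order.TTheory GRing.Theory Num.Theory.

Local Open Scope classical_set_scope.
Local Open Scope ring_scope.
Local Open Scope complex_scope.

(* A finite abelian group is a [finZmodType], written additively.  [R[i]] is
   the field of complex numbers over [R], [Normc.normc z : R] the modulus and
   [z^*] the complex conjugate ([Num.conj], definitionally [conjc]). *)

Definition dual_group (R : realType) (G : finZmodType) : set (G -> R[i]) :=
  [set xi : G -> R[i] | (forall x y, xi (x + y) = xi x * xi y) /\
                        (forall x, Normc.normc (xi x) = 1)].

(* The zero of the dual group, written additively, is the constant 1. *)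
Definition nontrivial_characters (R : realType) (G : finZmodType) :
    set (G -> R[i]) :=
  [set xi : G -> R[i] | dual_group xi /\ xi <> (fun=> 1)].

Definition fourier (R : realType) (G : finZmodType) (f xi : G -> R[i]) : R[i] :=
  \sum_(g : G) f g * (xi g)^*.

Definition indicator (R : realType) (G : finZmodType) (A : {set G}) :
    G -> R[i] :=
  fun g => (g \in A)%:R.

Definition diffset (G : finZmodType) (A B : {set G}) : {set G} :=
  [set a - b | a in A, b in B]%SET.

Definition translate (G : finZmodType) (A : {set G}) (x : G) : {set G} :=
  [set a + x | a in A]%SET.

(* [rho A] is 0 when [G] is trivial. *)
Definition rho (G : finZmodType) (A : {set G}) : nat :=
  (\max_(x : G | x != 0%R) #|A :&: translate A x|)%N.

(* There are finitely many characters, so the supremum is a maximum as soon as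
   a nontrivial character exists, see [maxfourierP]; it is 0 when [G] is
   trivial. *)
Definition maxfourier (R : realType) (G : finZmodType) (A : {set G}) : R :=
  sup [set Normc.normc (fourier (indicator R A) xi)
        | xi in @nontrivial_characters R G].

Lemma dual_group_root_of_unity (R : realType) (G : finZmodType)
    (xi : G -> R[i]) (x : G) : dual_group xi -> xi x ^+ #|G| = 1.
Proof.
move=> [xiD xi1].
have prod_neq0 : \prod_(y : G) xi y != 0.
  apply/prodf_neq0 => y _; apply/eqP => xiy0; have := xi1 y.
  by rewrite xiy0 Normc.normc0 => /eqP; rewrite eq_sym oner_eq0.
apply: (mulIf prod_neq0); rewrite mul1r.
rewrite [RHS](reindex_inj (addrI x)) /=.
under [RHS]eq_bigr do rewrite xiD.
by rewrite big_split /= prodr_const.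
Qed.

Lemma maxfourierP (R : realType) (G : finZmodType) (A : {set G})
    (F := fun xi : G -> R[i] => Normc.normc (fourier (indicator R A) xi)) :
  @nontrivial_characters R G !=set0 ->
  (exists2 xi, nontrivial_characters xi & maxfourier R A = F xi) /\
  (forall xi, nontrivial_characters xi -> F xi <= maxfourier R A).
Proof.
move=> [xi0 Pxi0].
have [r rP] := closed_field_poly_normal ('X^#|G| - 1 : {poly R[i]}).
have cardG : (0 < #|G|)%N by apply/card_gt0P; exists 0.
pose dec (t : {ffun G -> 'I_(size r)}) : G -> R[i] := fun g => r`_(t g).
have decP xi : nontrivial_characters xi -> exists t, dec t = xi.
  move=> [xid _].
  have xir g : xi g \in r.
    have : root ('X^#|G| - 1) (xi g).
      by rewrite /root !hornerE dual_group_root_of_unity ?subrr.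
    rewrite rP lead_coefDl ?lead_coefXn ?scale1r ?root_prod_XsubC //.
    by rewrite size_polyN size_poly1 size_polyXn ltnS.
  have ltr g : (index (xi g) r < size r)%N by rewrite index_mem.
  exists [ffun g => Ordinal (ltr g)]; apply/funext => g.
  by rewrite /dec ffunE /= nth_index.
have [t0 e0] := decP _ Pxi0.
pose P t := `[< nontrivial_characters (dec t) >].
have Pt0 : P t0 by apply/asboolP; rewrite e0.
case: (@Order.TotalTheory.arg_maxP _ _ _ t0 P (F \o dec) Pt0) => t /asboolP Pt tmax.
have ub xi : nontrivial_characters xi -> F xi <= F (dec t).
  move=> Pxi; have [s es] := decP _ Pxi; rewrite -es.
  by apply: tmax; apply/asboolP; rewrite es.
have -> : maxfourier R A = F (dec t).
  apply/eqP; rewrite eq_le; apply/andP; split.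
    apply: ge_sup; first by exists (F (dec t)), (dec t).
    by move=> _ [xi Pxi <-]; exact: ub.
  apply: ub_le_sup; last by exists (dec t).
  by exists (F (dec t)) => _ [xi Pxi <-]; exact: ub.
by split => //; exists (dec t).
Qed.

(* Main.v *)
Require Import Defs.
From mathcomp Require Import all_boot all_order all_algebra.
From mathcomp Require Import all_fingroup all_solvable all_field all_character.
From mathcomp Require Import complex ring lra.
From mathcomp Require Import reals sequences exp.

Import Order.TTheory GRing.Theory Num.Theory.
Local Open Scope complex_scope.
Local Open Scope ring_scope.

(* Write D = A - A and B_x = B ∩ (A + x) for B ⊆ A. Among the nonempty B ⊆ A
   take one minimising ln |A - B| - α ln |B| with α = e / ln (K / e). Then
   |A - B_x| >= (1 - e) |A - B| as soon as |B_x| >= (e / K) |B|, which holds for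
   all but a proportion e of the differences x = b - a, while the hypothesis on
   ln K keeps |B| >= K / e.

   Put S = A - B. Since A - B_x ⊆ S ∩ (D - x) (Katz-Koester), some b in B
   satisfies s + b - a ∈ D for at least (1 - e)^2 |S| |A| pairs (s, a). By
   Fourier inversion, Cauchy-Schwarz and Parseval the number of these pairs is
   at most |S| |A| |D| / |G| + M(A) sqrt (|S| |D|), whence
   M(A)^2 K >= (1 - O(e)) |S| |A|. Finally, bounding the additive energy of A
   and B below by |A|^2 |B|^2 / |S| and above by ρ(A) |B|^2 + |A| |B| gives
   |S| ρ(A) >= (1 - e) |A|^2. *)

(** * Characters encoded by exponents of a root of unity, and their orthogonality *)

(* For w a primitive root of unity of order #|G|, these index the characters
   g |-> w ^+ t g of G; no claim that they exhaust the dual group is needed. *)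
Definition additive_exponents (G : finZmodType) (n : nat) :
    {set {ffun G -> 'I_n.+1}} :=
  [set t : {ffun G -> 'I_n.+1} |
     [forall x, [forall y, t (x + y) == t x + t y]]].

Lemma additive_exponentsP (G : finZmodType) (n : nat)
    (t : {ffun G -> 'I_n.+1}) :
  reflect {morph t : x y / x + y} (t \in additive_exponents G n).
Proof.
rewrite inE; apply: (iffP forallP) => [tD x y|tD x]; last first.
  by apply/forallP => y; rewrite tD.
by apply/eqP; have /forallP := tD x.
Qed.

(* The irreducible characters over [algC] separate the points of G, and their
   values are powers of one root of unity, whose exponents can be transported to
   any other field. *)
Lemma additive_exponents_sep (G : finZmodType) (x : G) : x != 0 ->
  exists2 t, t \in additive_exponents G #|G|.-1 & t x != 0.
Proof.
move=> x0; have cG : (0 < #|G|)%N by apply/card_gt0P; exists 0.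
have [i xi] : exists i : Iirr [set: G], x \notin cfker 'chi_i.
  apply/existsP; rewrite -negb_forall; apply: contra x0 => /forallP xker.
  have : x \in \bigcap_i cfker ('chi[[set: G]]_i) by apply/bigcapP.
  by rewrite TI_cfker_irr inE FinRing.zmod1gE.
have /char_abelianP/(_ i) lini := FinRing.zmod_abelian [set: G].
have [z zP] := C_prim_root_exists cG.
have xiN g : 'chi_i g ^+ #|G| = 1.
  rewrite -lin_charX ?inE // -cardsT.
  by rewrite expg_cardG ?inE // lin_char1.
pose k g := sval (prim_rootP zP (xiN g)).
have kE g : 'chi_i g = z ^+ k g by rewrite /k; case: prim_rootP.
have zE g : z ^+ (inord (k g) : 'I_#|G|.-1.+1) = 'chi_i g.
  by rewrite inordK ?prednK // kE.
exists [ffun g => inord (k g)].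
  apply/additive_exponentsP => g h; rewrite !ffunE; apply/val_inj/eqP => /=.
  have zP' : #|G|.-1.+1.-primitive_root z by rewrite prednK.
  rewrite -[X in X == _](modn_small (ltn_ord _)) -(eq_prim_root_expr zP').
  by rewrite exprD !zE -FinRing.zmodMgE lin_charM ?inE.
apply: contra xi; rewrite ffunE => /eqP kx.
by rewrite (cfkerEchar (irr_char i)) !inE (lin_char1 lini) -zE kx expr0 /=.
Qed.

(** Since n is nonzero in [F], X^n - 1 is separable and has n distinct roots; n distinct n-th roots
    of unity include a primitive one. *)
Lemma ex_prim_root (F : closedFieldType) (n : nat) : (0 < n)%N ->
  n%:R != 0 :> F -> exists w : F, n.-primitive_root w.
Proof.
move=> n0 nF; have [r rP] := closed_field_poly_normal ('X^n - 1 : {poly F}).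
have lc : lead_coef ('X^n - 1 : {poly F}) = 1.
  by rewrite lead_coefDl ?lead_coefXn // size_polyN size_poly1 size_polyXn ltnS.
rewrite lc scale1r in rP.
have sr : size r = n.
  by apply/eqP; rewrite -eqSS -(size_prod_XsubC r id) -rP size_XnsubC.
have ur : uniq r.
  by rewrite -separable_prod_XsubC -rP separable_Xn_sub_1.
have : has n.-primitive_root r.
  apply: has_prim_root => //; last by rewrite sr.
  by apply/allP => y yr; rewrite unity_rootE -subr_eq0; move: yr;
    rewrite -root_prod_XsubC -rP /root !hornerE.
by move=> /hasP [w _ ?]; exists w.
Qed.

Lemma expr_ordD (F : fieldType) (n : nat) (w : F) (a b : 'I_n.+1) :
  w ^+ n.+1 = 1 -> w ^+ (a + b)%R = w ^+ a * w ^+ b.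
Proof. by move=> w1; rewrite /= expr_mod // exprD. Qed.

(** For u nonzero, translating the exponents by one that does not vanish at u multiplies the sum by
    a number other than 1, so it is 0. That leaves the number of exponents to find: the double sum
    over exponents and points equals it, and also equals |G| because only t = 0 contributes. *)
Lemma sum_additive_exponents (G : finZmodType) (F : fieldType) (w : F) (u : G) :
  #|G|.-primitive_root w ->
  \sum_(t in additive_exponents G #|G|.-1) w ^+ t u
    = (#|G| * (u == 0%R))%:R.
Proof.
move=> wP; set X := additive_exponents _ _.
have cG : (0 < #|G|)%N by apply/card_gt0P; exists 0.
have w1 : w ^+ #|G|.-1.+1 = 1 by rewrite prednK // prim_expr_order.
have wN1 (a : 'I_#|G|.-1.+1) : a != 0 -> w ^+ a != 1.
  apply: contra; rewrite -(expr0 w) (eq_prim_root_expr wP) mod0n.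
  by rewrite modn_small // -[X in (_ < X)%N](prednK cG).
have sumX v : \sum_(t in X) w ^+ t v = (#|X| * (v == 0%R))%:R.
  have [->|v0] := eqVneq v 0.
    rewrite muln1 -sum1_card natr_sum.
    apply: eq_bigr => t /additive_exponentsP tD.
    have /eqP : t 0 = t 0 + t 0 by rewrite -tD addr0.
    by rewrite eq_sym addrC -subr_eq0 addrK => /eqP ->.
  rewrite muln0; have [s sX sv] := additive_exponents_sep G v v0.
  apply/eqP; set Q := \sum_(t in X) _.
  have : Q = w ^+ s v * Q.
    rewrite {1}/Q (reindex_inj (addrI s)) /= mulr_sumr.
    apply: eq_big => [t|t _]; last by rewrite ffunE expr_ordD.
    apply/additive_exponentsP/additive_exponentsP => tD x y.
      have /additive_exponentsP sD := sX.
      apply: (addrI (s (x + y))); have := tD x y; rewrite !ffunE => ->.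
      by rewrite sD addrACA.
    by have /additive_exponentsP sD := sX; rewrite !ffunE tD sD addrACA.
  move=> /eqP; rewrite -subr_eq0 -{1}[Q]mul1r -mulrBl mulf_eq0 subr_eq0.
  by case/orP => //; rewrite eq_sym (negPf (wN1 _ sv)).
rewrite sumX !natrM; congr (_ * _).
have <- : \sum_(v : G) \sum_(t in X) w ^+ t v = #|X|%:R.
  rewrite (bigD1 0) //= sumX eqxx muln1 big1 ?addr0 // => v v0.
  by rewrite sumX (negPf v0) muln0.
have X0 : 0 \in X by apply/additive_exponentsP => x y; rewrite !ffunE addr0.
rewrite exchange_big (bigD1 (0 : {ffun G -> 'I_#|G|.-1.+1})) //=.
rewrite [X in X + _](_ : _ = #|G|%:R); last first.
  by under eq_bigr do rewrite ffunE expr0; rewrite sumr_const.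
rewrite big1 ?addr0 // => t /andP[/additive_exponentsP tD t0].
have [v tv] : exists v, t v != 0.
  apply/existsP; rewrite -negb_forall; apply: contra t0 => /forallP t0.
  by apply/eqP/ffunP => v; rewrite ffunE; apply/eqP.
apply/eqP; set Q := \sum_v _.
have : Q = w ^+ t v * Q.
  rewrite {1}/Q (reindex_inj (addrI v)) /= mulr_sumr.
  by apply: eq_bigr => y _; rewrite tD expr_ordD.
move=> /eqP; rewrite -subr_eq0 -{1}[Q]mul1r -mulrBl mulf_eq0 subr_eq0.
by case/orP => //; rewrite eq_sym (negPf (wN1 _ tv)).
Qed.

(** * Cauchy-Schwarz and nonnegativity of Fourier maxima *)

(** Lagrange's identity: twice the defect is a sum of squares over pairs. Doubling avoids any
    division, so the inequality also applies over [int]. *)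
Lemma cauchy_schwarz_sum (R : realDomainType) (I : finType) (P : pred I)
    (u v : I -> R) :
  (\sum_(i | P i) u i * v i) ^+ 2
    <= (\sum_(i | P i) u i ^+ 2) * (\sum_(i | P i) v i ^+ 2).
Proof.
rewrite -subr_ge0 -(pmulrn_lge0 _ (isT : (0 < 2)%N)).
suff -> : ((\sum_(i | P i) u i ^+ 2) * (\sum_(i | P i) v i ^+ 2)
    - (\sum_(i | P i) u i * v i) ^+ 2) *+ 2
  = \sum_(i | P i) \sum_(j | P j) (u i * v j - u j * v i) ^+ 2.
  by apply: sumr_ge0 => i _; apply: sumr_ge0 => j _; exact: sqr_ge0.
set U := \sum_(i | P i) u i ^+ 2; set V := \sum_(i | P i) v i ^+ 2.
have E1 : U * V = \sum_(i | P i) \sum_(j | P j) u i ^+ 2 * v j ^+ 2.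
  by rewrite big_distrlr.
have E2 : U * V = \sum_(i | P i) \sum_(j | P j) u j ^+ 2 * v i ^+ 2.
  by rewrite E1 exchange_big.
rewrite mulrnBl mulr2n {1}E1 E2 expr2 big_distrlr /=.
rewrite -sumrMnl -sumrN -!big_split /=.
apply: eq_bigr => i _; rewrite -sumrMnl -sumrN -!big_split /=.
by apply: eq_bigr => j _; ring.
Qed.

Lemma normc_ge0 (R : rcfType) (z : R[i]) : 0 <= Normc.normc z.
Proof. by case: z => a b; exact: sqrtr_ge0. Qed.

Lemma maxfourier_ge0 (R : realType) (G : finZmodType) (A : {set G}) :
  0 <= maxfourier R A.
Proof.
have [[xi xiP]|no] := boolp.pselect (exists xi, @nontrivial_characters R G xi).
  have [_ /(_ _ xiP)] := maxfourierP A (ex_intro _ xi xiP).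
  by apply: le_trans; exact: normc_ge0.
(* Without nontrivial characters the supremum is that of the empty set, which is 0 by convention. *)
rewrite /maxfourier (_ : @nontrivial_characters R G = classical_sets.set0).
  by rewrite classical_sets.image_set0 sup0.
by rewrite -classical_sets.subset0 => xi xiP; case: no; exists xi.
Qed.

(** * Fourier analysis of the counting form *)

Section FourierForm.
Variables (R : realType) (G : finZmodType) (w : R[i]).
Hypothesis wP : #|G|.-primitive_root w.
Local Notation X := (additive_exponents G #|G|.-1).

Let chi (t : {ffun G -> 'I_#|G|.-1.+1}) (g : G) : R[i] := w ^+ t g.

Let cG : (0 < #|G|)%N. Proof. by apply/card_gt0P; exists 0. Qed.

Let chiD t : t \in X -> forall x y, chi t (x + y) = chi t x * chi t y.
Proof.
move=> /additive_exponentsP tD x y; rewrite /chi tD expr_ordD //.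
by rewrite prednK // prim_expr_order.
Qed.

Let normc_chi t x : Normc.normc (chi t x) = 1.
Proof.
have normcX n (z : R[i]) : Normc.normc (z ^+ n) = Normc.normc z ^+ n.
  by elim: n => [|n IH]; rewrite ?expr0 ?Normc.normc1 // !exprS Normc.normcM IH.
have w1 : Normc.normc w = 1.
  apply/eqP; rewrite -(@pexpr_eq1 _ _ #|G|) ?normc_ge0 //.
  by rewrite -normcX prim_expr_order // Normc.normc1.
by rewrite normcX w1 expr1n.
Qed.

Let chi_neq0 t x : chi t x != 0.
Proof.
apply/eqP => c0; have := normc_chi t x.
by rewrite c0 Normc.normc0 => /esym/eqP; rewrite oner_eq0.
Qed.

Let chi_dual t : t \in X -> dual_group (chi t).
Proof. by move=> tX; split; [exact: chiD|exact: normc_chi]. Qed.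

Let chi_nontrivial t : t \in X -> t != 0 -> nontrivial_characters (chi t).
Proof.
move=> tX t0; split; first exact: chi_dual.
move=> t1; case/negP: t0; apply/eqP/ffunP => g; rewrite ffunE; apply/val_inj.
apply/eqP; have := congr1 (@^~ g) t1; rewrite /chi /= => /eqP.
(* w ^+ t g = w ^+ 0 makes |G| divide t g, which is smaller than |G|. *)
rewrite -(expr0 w) (eq_prim_root_expr wP) mod0n.
by rewrite modn_small // -[X in (_ < X)%N](prednK cG).
Qed.

(** Both sides are inverses of chi t g: the left because the modulus is 1, the right by
    multiplicativity. *)
Let chi_conj t g : t \in X -> (chi t g)^* = chi t (- g).
Proof.
move=> tX; have cn : chi t g * (chi t g)^* = 1.
  rewrite -normCK (_ : `|chi t g| = (Normc.normc (chi t g))%:C) //.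
  by rewrite normc_chi expr1n.
have : chi t g * chi t (- g) = 1.
  rewrite -chiD // subrr; apply: (mulfI (chi_neq0 t 0)).
  by rewrite -chiD // addr0 mulr1.
by rewrite -cn => /(mulfI (chi_neq0 t g)).
Qed.

Let FE (E : {set G}) t := fourier (indicator R E) (chi t).

Let fourier_chi E t : t \in X -> FE E t = \sum_(g in E) chi t (- g).
Proof.
move=> tX; rewrite /FE /fourier [RHS]big_mkcond; apply: eq_bigr => g _.
by rewrite chi_conj // /indicator; case: (g \in E); rewrite ?mul1r ?mul0r.
Qed.

Let fourier_chi_conj E t : t \in X -> (FE E t)^* = \sum_(g in E) chi t g.
Proof.
move=> tX; rewrite fourier_chi // rmorph_sum; apply: eq_bigr => g _.
by rewrite /= chi_conj // opprK.
Qed.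

Let sum_chi u : \sum_(t in X) chi t u = (#|G| * (u == 0%R))%:R.
Proof. exact: sum_additive_exponents. Qed.

Let sum_eq_mem (E : {set G}) g : (\sum_(h in E) (g == h) = (g \in E) :> nat)%N.
Proof.
have [gE|gE] := boolP (g \in E).
  rewrite (bigD1 g) //= eqxx big1 // => h /andP[_ hg].
  by rewrite eq_sym (negPf hg).
by rewrite big1 // => h hE; case: eqP => // gh; rewrite gh hE in gE.
Qed.

(** Expanding the squared modulus gives a sum of chi t (h - g) over g and h in E; orthogonality
    leaves the diagonal. *)
Let parseval E : \sum_(t in X) Normc.normc (FE E t) ^+ 2 = (#|G| * #|E|)%:R.
Proof.
apply: complexI; rewrite rmorph_sum rmorph_nat /=.
have -> : (#|G| * #|E|)%N%:R
    = \sum_(h in E) \sum_(g in E) \sum_(t in X) chi t (h - g) :> R[i].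
  under eq_bigr do under eq_bigr do rewrite sum_chi subr_eq0.
  under eq_bigr do rewrite -natr_sum -big_distrr /= sum_eq_mem.
  rewrite -natr_sum -big_distrr /=; congr (_ * _)%:R.
  by rewrite -sum1_card; apply: eq_bigr => h ->.
under [RHS]eq_bigr do rewrite exchange_big; rewrite [RHS]exchange_big /=.
apply: eq_bigr => t tX; rewrite rmorphXn /=.
rewrite -[(Normc.normc _)%:C]/(`|FE E t|) normCK mulrC fourier_chi_conj //.
rewrite fourier_chi // big_distrlr /=; apply: eq_bigr => h _.
by apply: eq_bigr => g _; rewrite chiD.
Qed.

(** Summing chi t (s + b - a - d) over t detects d = s + b - a. Only S is conjugated because s
    alone, besides b, enters with a plus sign. *)
Lemma fourier_form_count (A S D : {set G}) (b : G) :
  \sum_(t in X) chi t b * ((FE S t)^* * FE A t * FE D t)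
    = (#|G| * \sum_(a in A) \sum_(s in S) ((s + b - a)%R \in D))%:R.
Proof.
transitivity (\sum_(a in A) \sum_(s in S) \sum_(d in D) \sum_(t in X)
    chi t (s + b - a - d)); last first.
  rewrite big_distrr natr_sum; apply: eq_bigr => a _.
  rewrite big_distrr natr_sum; apply: eq_bigr => s _.
  under eq_bigr do rewrite sum_chi subr_eq0.
  by rewrite -natr_sum -big_distrr /= sum_eq_mem.
under [RHS]eq_bigr do under eq_bigr do rewrite exchange_big.
under [RHS]eq_bigr do rewrite exchange_big.
rewrite [RHS]exchange_big; apply: eq_bigr => t tX.
rewrite fourier_chi_conj // !fourier_chi //.
set SS := \sum_(g in S) _; set SA := \sum_(g in A) _; set SD := \sum_(g in D) _.
have -> : chi t b * (SS * SA * SD) = SA * (SS * (chi t b * SD)) by ring.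
rewrite mulr_suml; apply: eq_bigr => a _; rewrite mulr_suml mulr_sumr.
apply: eq_bigr => s _; rewrite !mulr_sumr; apply: eq_bigr => d _.
by rewrite !chiD //; ring.
Qed.

(** The term t = 0 is |S| |A| |D|. In the others the transform of A is at most [maxfourier R A], and
    Cauchy-Schwarz with Parseval bounds the remaining sum. *)
Lemma fourier_form_bound (A S D : {set G}) (b : G) :
  (#|G| * \sum_(a in A) \sum_(s in S) ((s + b - a)%R \in D))%:R
    <= (#|S| * #|A| * #|D|)%:R
       + maxfourier R A * (#|G|%:R * Num.sqrt (#|S| * #|D|)%:R).
Proof.
have X0 : 0 \in X by apply/additive_exponentsP => x y; rewrite !ffunE addr0.
pose rest := \sum_(t in X | t != 0) chi t b * ((FE S t)^* * FE A t * FE D t).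
have FE0 E : FE E 0 = #|E|%:R.
  rewrite fourier_chi // -sum1_card natr_sum; apply: eq_bigr => g _.
  by rewrite /chi ffunE expr0.
have := fourier_form_count A S D b.
set Q := (\sum_(a in A) _)%N.
rewrite (bigD1 (0 : {ffun G -> 'I_#|G|.-1.+1})) //= -/rest !FE0.
rewrite {1}/chi ffunE expr0 mul1r.
rewrite conjC_nat -!natrM => countE.
(* As a difference of two natural numbers [rest] is real, so the real inequality follows from a
   bound on its modulus. *)
have restC : rest = ((#|G| * Q)%:R - (#|S| * #|A| * #|D|)%:R)%:C.
  by rewrite rmorphB !rmorph_nat -countE addrAC subrr add0r.
rewrite -lerBlDl; apply: le_trans (ler_norm _) _; rewrite -lecR.
have -> (r : R) : `|r|%:C = `|r%:C|.
  by rewrite normc_def /= expr0n addr0 sqrtr_sqr.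
rewrite -restC; apply: le_trans (ler_norm_sum _ _ _) _.
have normE t : `|chi t b * ((FE S t)^* * FE A t * FE D t)|
    = (Normc.normc (FE A t) * (Normc.normc (FE S t) * Normc.normc (FE D t)))%:C.
  rewrite !normrM norm_conjC !rmorphM /=.
  rewrite (_ : `|chi t b| = 1) ?mul1r; last first.
    by rewrite (_ : `|chi t b| = (Normc.normc (chi t b))%:C) // normc_chi.
  by rewrite [X in X * _]mulrC mulrA.
under eq_bigr do rewrite normE.
rewrite -rmorph_sum lecR.
apply: (@le_trans _ _ (maxfourier R A * \sum_(t in X)
    Normc.normc (FE S t) * Normc.normc (FE D t))).
  (* The nonnegative term t = 0 is put back so that Parseval applies to the whole sum. *)
  rewrite mulr_sumr [leRHS](bigD1 (0 : {ffun G -> 'I_#|G|.-1.+1})) //=.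
  rewrite ler_wpDl //.
    by rewrite mulr_ge0 ?maxfourier_ge0 ?mulr_ge0 ?normc_ge0.
  apply: ler_sum => t /andP[tX t0]; apply: ler_wpM2r.
    by rewrite mulr_ge0 ?normc_ge0.
  have tn := chi_nontrivial t tX t0.
  by have [_ /(_ _ tn)] := maxfourierP A (ex_intro _ _ tn).
apply: ler_wpM2l; first exact: maxfourier_ge0.
rewrite -ler_sqr ?nnegrE; first last.
- by rewrite mulr_ge0 ?sqrtr_ge0 // ler0n.
- by apply: sumr_ge0 => t _; rewrite mulr_ge0 ?normc_ge0.
apply: le_trans (cauchy_schwarz_sum _ _ _ _ _) _.
rewrite !parseval exprMn sqr_sqrtr ?ler0n // !natrM.
by rewrite mulrACA -expr2.
Qed.
End FourierForm.

(** * Difference sets and additive energy *)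

Lemma mem_translate (G : finZmodType) (A : {set G}) (x g : G) :
  (g \in translate A x) = (g - x \in A).
Proof.
apply/imsetP/idP => [[a aA ->]|gA]; first by rewrite addrK.
by exists (g - x); rewrite ?subrK.
Qed.

Lemma mem_diffset (G : finZmodType) (A B : {set G}) (a b : G) :
  a \in A -> b \in B -> a - b \in diffset A B.
Proof. by move=> aA bB; apply/imset2P; exists a b. Qed.

Lemma diffset_le (G : finZmodType) (A B : {set G}) :
  (0 < #|B|)%N -> (#|A| <= #|diffset A B|)%N.
Proof.
case/card_gt0P => b bB; rewrite -(card_imset _ (addIr (- b))).
by apply/subset_leq_card/subsetP => _ /imsetP[a aA ->]; exact: mem_diffset.
Qed.

Lemma card_sum_mem (G : finZmodType) (A : {set G}) :
  (\sum_(g : G) (g \in A) = #|A|)%N.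
Proof.
by rewrite -sum1_card [RHS]big_mkcond; apply: eq_bigr => g _; case: ifP.
Qed.

(** Let u s be the number of representations s = a - b. Cauchy-Schwarz on A - B bounds the square of
    the sum of u, and the sum of u^2 is that of |A ∩ (A + b - c)| over b, c in B: the diagonal gives
    |A| |B|, every other term is at most [rho A]. *)
Lemma energy_le (G : finZmodType) (A B : {set G}) :
  ((#|A| * #|B|) ^ 2
     <= #|diffset A B| * (rho A * #|B| ^ 2 + #|A| * #|B|))%N.
Proof.
pose u s := (\sum_(b in B) ((s + b)%R \in A))%N.
have uS : (\sum_(s in diffset A B) u s = #|A| * #|B|)%N.
  rewrite exchange_big /= mulnC -sum_nat_const; apply: eq_bigr => b bB.
  rewrite -card_sum_mem [RHS](reindex_inj (addIr b)) big_mkcond /=.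
  apply: eq_bigr => s _; case: ifP => // /negP sS; apply/esym/eqP; rewrite eqb0.
  by apply: contra_notN sS => sA; rewrite -(addrK b s) mem_diffset.
have u2 : (\sum_(s in diffset A B) u s ^ 2
    <= rho A * #|B| ^ 2 + #|A| * #|B|)%N.
  apply: (@leq_trans (\sum_(s : G) u s ^ 2)).
    by rewrite [leqRHS](bigID (mem (diffset A B))) /= leq_addr.
  have -> : (\sum_(s : G) u s ^ 2
      = \sum_(b in B) \sum_(c in B) #|A :&: translate A (b - c)%R|)%N.
    under [LHS]eq_bigr do rewrite -mulnn big_distrlr /=.
    rewrite [LHS]exchange_big; apply: eq_bigr => b bB.
    rewrite [LHS]exchange_big; apply: eq_bigr => c cB.
    rewrite -card_sum_mem [RHS](reindex_inj (addIr b)) /=.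
    apply: eq_bigr => s _; rewrite inE mem_translate mulnb.
    by rewrite opprB [c - b]addrC addrA addrK.
  apply: (@leq_trans (\sum_(b in B) (rho A * #|B| + #|A|))); last first.
    by rewrite sum_nat_const; apply: eq_leq; ring.
  apply: leq_sum => b bB; rewrite (bigD1 b) //= addnC leq_add //; last first.
    by rewrite subset_leq_card // subsetIl.
  rewrite mulnC -sum_nat_const [leqRHS](bigD1 b) //=.
  apply: leq_trans (leq_addl _ _); apply: leq_sum => c /andP[_ cb].
  by rewrite leq_bigmax_cond // subr_eq0 eq_sym.
apply: leq_trans (leq_mul (leqnn _) u2).
have := cauchy_schwarz_sum int _ (fun s => s \in diffset A B)
  (fun s => (u s)%:R) (fun=> 1) => /=.
under eq_bigr do rewrite mulr1.
under [X in _ <= X * _]eq_bigr do rewrite -natrX.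
under [X in _ <= _ * X]eq_bigr do rewrite expr1n.
rewrite sumr_const -!natr_sum uS -natrX -natrM ler_nat.
by rewrite [X in (_ <= X)%N -> _]mulnC.
Qed.

(** * Katz-Koester inclusion and popular differences *)

(** If c lies in B and c - x in A, then s = a - c satisfies s + x = a - (c - x), a difference of
    elements of A. *)
Lemma diffset_inter_le (G : finZmodType) (A B : {set G}) (x : G) :
  (#|diffset A (B :&: translate A x)|
     <= \sum_(s in diffset A B) ((s + x)%R \in diffset A A))%N.
Proof.
rewrite -sum1_card -big_mkcondr /= [leqRHS]big_mkcond [leqLHS]big_mkcond /=.
apply: leq_sum => s _; case: ifP => // /imset2P[a c aA].
rewrite inE mem_translate => /andP[cB cA] ->.
rewrite mem_diffset //= (_ : a - c + x = a - (c - x)) ?mem_diffset //.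
by rewrite opprB addrA addrAC.
Qed.

(** The pairs with b - a = x correspond to the elements b of B ∩ (A + x). *)
Lemma sum_pairs_diff (G : finZmodType) (A B : {set G}) (P : pred G) :
  (\sum_(b in B) \sum_(a in A) P (b - a)%R
     = \sum_(x | P x) #|B :&: translate A x|)%N.
Proof.
rewrite [RHS]big_mkcond /=.
transitivity (\sum_(b in B) \sum_(x : G) P x * ((b - x)%R \in A))%N.
  apply: eq_bigr => b _; rewrite big_mkcond.
  rewrite (reindex_inj (inj_comp (addrI b) oppr_inj)) /=.
  apply: eq_bigr => x _; rewrite opprB addrCA subrr addr0.
  by case: ifP; rewrite ?muln1 ?muln0.
rewrite exchange_big; apply: eq_bigr => x _ /=; rewrite -big_distrr /=.
case: (P x); rewrite ?mul1n ?mul0n // -card_sum_mem big_mkcond.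
by apply: eq_bigr => b _; rewrite inE mem_translate; case: (b \in B).
Qed.

(** Grouped by difference x, the pairs contribute fewer than tau for each rare x, and x must lie in
    A - A because B is contained in A. *)
Lemma sum_rare_pairs_le (R : realFieldType) (G : finZmodType) (A B : {set G})
    (tau : R) : B \subset A -> 0 <= tau ->
  (\sum_(b in B) \sum_(a in A)
      (#|B :&: translate A (b - a)|%:R < tau)%R)%:R
    <= #|diffset A A|%:R * tau.
Proof.
move=> BA tau0.
rewrite (sum_pairs_diff _ A B (fun x => #|B :&: translate A x|%:R < tau)).
rewrite natr_sum mulr_natl -sumr_const big_mkcond [leRHS]big_mkcond /=.
apply: ler_sum => x _; case: ifP => xtau; case: ifP => [xD|/negP xD] //.
  exact: ltW.
rewrite (_ : #|_| = 0%N) //; apply/eqP; rewrite cards_eq0; apply/set0Pn => -[b].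
rewrite inE mem_translate => /andP[bB bA]; apply: xD.
by rewrite -(subKr b x) mem_diffset // (fintype.subsetP BA).
Qed.

(** Averaging over b in B. One factor 1 - e pays for the pairs with a rare difference, the other for
    passing from A - B to A - B_x at a popular one. *)
Lemma ex_popular_shift (R : realFieldType) (G : finZmodType) (A B : {set G})
    (K e : R) : B \subset A -> (0 < #|B|)%N -> 0 < K -> 0 < e -> e <= 1 ->
  #|diffset A A|%:R = K * #|A|%:R ->
  (forall x, e / K * #|B|%:R <= #|B :&: translate A x|%:R ->
     (1 - e) * #|diffset A B|%:R <= #|diffset A (B :&: translate A x)|%:R) ->
  exists2 b, b \in B &
    (1 - e) ^+ 2 * (#|diffset A B| * #|A|)%:R
      <= (\sum_(a in A) \sum_(s in diffset A B)
            ((s + b - a)%R \in diffset A A))%:R :> R.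
Proof.
move=> BA B0 K0 e0 e1 DK popular; set S := diffset A B.
pose f b := (\sum_(a in A) \sum_(s in S) ((s + b - a)%R \in diffset A A))%N.
pose rare (b a : G) : nat :=
  (#|B :&: translate A (b - a)|%:R < e / K * #|B|%:R)%R.
have [/exists_inP[b bB fb]|] := boolP [exists b in B,
    (1 - e) ^+ 2 * (#|S| * #|A|)%:R <= (f b)%:R]; first by exists b.
rewrite negb_exists_in => /forall_inP small.
have fge b :
    (\sum_(a in A) (1 - (rare b a)%:R)) * ((1 - e) * #|S|%:R) <= (f b)%:R.
  rewrite mulr_suml natr_sum; apply: ler_sum => a _; rewrite /rare.
  case: ltP => [_|/popular]; first by rewrite subrr mul0r ler0n.
  rewrite subr0 mul1r => /le_trans; apply; rewrite ler_nat.
  apply: leq_trans (diffset_inter_le _ A B _) _.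
  by apply: eq_leq; apply: eq_bigr => s _; rewrite addrA.
(* The threshold e |B| / K is tuned to |A - A| = K |A|: their product is e |A| |B|. *)
have rareS : (\sum_(b in B) \sum_(a in A) rare b a)%:R <= e * (#|A| * #|B|)%:R.
  apply: le_trans (sum_rare_pairs_le _ _ _ _ _ BA _) _.
    by rewrite mulr_ge0 ?ler0n // divr_ge0 // ltW.
  rewrite DK natrM le_eqVlt; apply/orP; left; apply/eqP.
  by field; rewrite gt_eqF.
have lower : (1 - e) ^+ 2 * (#|S| * #|A| * #|B|)%:R <= \sum_(b in B) (f b)%:R.
  apply: le_trans (ler_sum _ (fun b _ => fge b)).
  rewrite -mulr_suml; under eq_bigr do rewrite sumrB sumr_const.
  rewrite sumrB sumr_const -mulrnA.
  under eq_bigr do rewrite -natr_sum; rewrite -natr_sum.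
  have -> : (1 - e) ^+ 2 * (#|S| * #|A| * #|B|)%:R
      = ((1 - e) * (#|A| * #|B|)%:R) * ((1 - e) * #|S|%:R).
    by rewrite !natrM; ring.
  apply: ler_wpM2r; first by rewrite mulr_ge0 ?subr_ge0 ?ler0n.
  by rewrite mulrBl mul1r natrM lerB // -natrM.
have [b0 b0B] := card_gt0P B0.
suff : \sum_(b in B) (f b)%:R < (1 - e) ^+ 2 * (#|S| * #|A| * #|B|)%:R.
  by rewrite ltNge lower.
rewrite natrM mulrA mulr_natr -sumr_const.
(* Strictness survives summation because B is nonempty. *)
apply: ltr_sum => [|b /small]; last by rewrite ltNge.
by apply/hasP; exists b0; rewrite ?mem_index_enum.
Qed.

Lemma fourier_form_le (R : realType) (G : finZmodType) (A S D : {set G})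
    (b : G) :
  (\sum_(a in A) \sum_(s in S) ((s + b - a)%R \in D))%:R
    <= (#|S| * #|A| * #|D|)%:R / #|G|%:R
       + maxfourier R A * Num.sqrt (#|S| * #|D|)%:R.
Proof.
have G0 : (0 < #|G|)%N by apply/card_gt0P; exists 0.
have [|w wP] := ex_prim_root R[i] #|G| G0; first by rewrite pnatr_eq0 -lt0n.
have GR : 0 < #|G|%:R :> R by rewrite ltr0n.
rewrite -(ler_pM2l GR) -natrM.
apply: le_trans (fourier_form_bound _ _ _ wP _ _ _ _) _.
by rewrite mulrDr [_ * (_ / _)]mulrC divfK ?gt_eqF // mulrCA.
Qed.

(** * Minimal subset for a penalised difference set *)

(** Comparing the minimiser with A itself, where |A - B| >= |A|, bounds |B| below. Comparing it with
    B_x, at most a factor K / e smaller, bounds |A - B_x| below. *)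
Lemma ex_minimal_subset (R : realType) (G : finZmodType) (A : {set G})
    (K e : R) : (0 < #|A|)%N -> 1 <= K -> 0 < e -> e < 1 ->
  #|diffset A A|%:R = K * #|A|%:R ->
  exists B : {set G}, [/\ B \subset A, (0 < #|B|)%N,
    ln #|A|%:R - ln K * ln (K / e) / e <= ln #|B|%:R &
    forall x, e / K * #|B|%:R <= #|B :&: translate A x|%:R ->
      (1 - e) * #|diffset A B|%:R <= #|diffset A (B :&: translate A x)|%:R].
Proof.
move=> A0 K1 e0 e1 DK.
have K0 : 0 < K by exact: lt_le_trans K1.
have Ke1 : 1 < K / e by rewrite ltr_pdivlMr // mul1r; exact: lt_le_trans K1.
have L0 : 0 < ln (K / e) by rewrite ln_gt0.
pose L := ln (K / e); pose alpha := e / L.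
have alpha0 : 0 < alpha by rewrite divr_gt0.
pose phi (B : {set G}) : R := ln #|diffset A B|%:R - alpha * ln #|B|%:R.
pose P (B : {set G}) := (B \subset A) && (0 < #|B|)%N.
have PA : P A by rewrite /P subxx A0.
case: (@Order.TotalTheory.arg_minP _ _ _ A P phi PA) => B /andP[BA B0] Bmin.
have D0 (C : {set G}) : (0 < #|C|)%N -> (0 < #|diffset A C|)%N.
  by move=> C0; exact: leq_trans A0 (diffset_le _ A C C0).
exists B; split => //.
  have := Bmin A PA; rewrite /phi DK lnM ?posrE ?ltr0n // => le_phi.
  have lnS : ln #|A|%:R <= ln #|diffset A B|%:R :> R.
    by rewrite ler_ln ?posrE ?ltr0n ?D0 // ler_nat diffset_le.
  have : alpha * (ln #|A|%:R - ln #|B|%:R) <= ln K by lra.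
  rewrite -ler_pdivlMl // /alpha invf_div -/L.
  rewrite lerBlDr => /le_trans h; rewrite lerBlDl; apply: h.
  by rewrite le_eqVlt; apply/orP; left; apply/eqP; field; rewrite gt_eqF.
move=> x xB; set C := B :&: translate A x.
have C0 : (0 < #|C|)%N.
  rewrite -(ltr0n R); apply: lt_le_trans xB.
  by rewrite mulr_gt0 ?divr_gt0 ?ltr0n.
have PC : P C by rewrite /P C0 andbT; exact: subset_trans (subsetIl _ _) BA.
have := Bmin C PC; rewrite /phi => le_phi.
have lnC : ln #|B|%:R - L <= ln #|C|%:R.
  rewrite /L -ln_div ?posrE ?ltr0n ?divr_gt0 //.
  rewrite ler_ln ?posrE ?divr_gt0 ?ltr0n //.
  by rewrite invf_div mulrC.
(* This fixes alpha: shrinking B by a factor K / e costs exactly e in the logarithm, and exp(-e) >=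
   1 - e. *)
have aL : alpha * L = e by rewrite /alpha divfK // gt_eqF.
have lnD : ln #|diffset A B|%:R - e <= ln #|diffset A C|%:R.
  have : alpha * (ln #|B|%:R - L) <= alpha * ln #|C|%:R by rewrite ler_pM2l.
  rewrite mulrBr aL; lra.
have : expR (ln #|diffset A B|%:R - e) <= expR (ln #|diffset A C|%:R).
  by rewrite ler_expR.
rewrite expRD !lnK ?posrE ?ltr0n ?D0 //; apply: le_trans.
by rewrite mulrC ler_pM2l ?ltr0n ?D0 // expR_ge1Dx.
Qed.

(** * Choice of constants and conclusion *)

Theorem theorem1 (R : realType) (eps : R) (eps_gt0 : 0 < eps) :
  exists eta C : R, [/\ 0 < eta, 0 < C &
    forall (G : finZmodType) (A : {set G}) (delta K : R),
      #|A|%:R = delta * #|G|%:R ->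
      #|diffset A A|%:R = K * #|A|%:R ->
      C <= #|A|%:R ->
      ln K ^+ 2 <= eta * ln #|A|%:R ->
      K ^+ 2 * delta <= eta ->
      (1 - eps) * (#|A|%:R ^+ 3 / K) <= maxfourier R A ^+ 2 * (rho A)%:R].
Proof.
(* The losses total (1 - 3e)^2 (1 - e) >= 1 - 7e. *)
pose e := Num.min eps 1 / 7.
have m0 : 0 < Num.min eps 1 by rewrite lt_min eps_gt0 ltr01.
have e0 : 0 < e by rewrite divr_gt0.
have e7eps : 7 * e <= eps by rewrite /e mulrC divfK ?ge_min ?lexx // pnatr_eq0.
have e71 : 7 * e <= 1.
  by rewrite /e mulrC divfK ?ge_min ?lexx ?orbT // pnatr_eq0.
pose c := ln e^-1.
have c0 : 0 <= c by rewrite ln_ge0 // -[leLHS]invr1 lef_pV2 ?posrE //; lra.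
(* With l = ln K, the bound |B| >= K / e amounts to l^2 + (c + e) l + c e <= e ln |A|. Here (c + e)
   l <= (l^2 + (c + e)^2) / 2, [eta] bounds l^2 by e ln |A| / 4, and [C] bounds (c + e)^2 + c e by e
   ln |A| / 2. *)
exists (e / 4), (expR (2 * ((c + e) ^+ 2 + c * e) / e)).
split; [by rewrite divr_gt0|exact: expR_gt0|].
move=> G A delta K Adelta DK CA lnK2 K2d.
have G0 : 0 < #|G|%:R :> R by rewrite ltr0n; apply/card_gt0P; exists 0.
have A0 : 0 < #|A|%:R :> R by exact: lt_le_trans (expR_gt0 _) CA.
have A0n : (0 < #|A|)%N by rewrite ltr0n in A0.
have K1 : 1 <= K.
  by rewrite -(ler_pM2r A0) mul1r -DK ler_nat diffset_le.
have K0 : 0 < K by exact: lt_le_trans K1.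
have e1 : e < 1 by lra.
have [B [BA B0 lnB Bpop]] := ex_minimal_subset _ _ _ _ _ A0n K1 e0 e1 DK.
have B0R : 0 < #|B|%:R :> R by rewrite ltr0n.
have KeB : K / e <= #|B|%:R.
  rewrite -ler_ln ?posrE ?divr_gt0 //; apply: le_trans lnB.
  have lnA : 2 * ((c + e) ^+ 2 + c * e) / e <= ln #|A|%:R.
    by rewrite -[leLHS]expRK ler_ln ?posrE ?expR_gt0.
  rewrite lnM ?posrE ?invr_gt0 // -/c; set l := ln K in lnK2 *.
  set La := ln _ in lnK2 lnA *; rewrite lerBrDr -(ler_pM2l e0) mulrDr.
  have -> : e * (l * (l + c) / e) = l * (l + c) by field; rewrite gt_eqF.
  have : 2 * ((c + e) ^+ 2 + c * e) <= e * La.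
    by rewrite -ler_pdivrMl // mulrC.
  have := sqr_ge0 (l - (c + e)); have := sqr_ge0 l; have := sqr_ge0 (c + e).
  nra.
have [b bB] := ex_popular_shift _ _ _ _ _ _ BA B0 K0 e0 (ltW e1) DK Bpop.
move=> /le_trans/(_ (fourier_form_le R _ _ _ _ _)).
have := energy_le _ A B; rewrite -(ler_nat R).
have := diffset_le _ A B B0; rewrite -(ler_nat R).
have : #|diffset A B|%:R <= #|diffset A A|%:R :> R.
  rewrite ler_nat; apply/subset_leq_card/fintype.subsetP.
  move=> _ /imset2P[a d aA dB ->].
  by rewrite mem_diffset // (fintype.subsetP BA).
rewrite !(natrM, natrD, natrX) DK; set M := maxfourier R A.
have M0 : 0 <= M := maxfourier_ge0 R G A.
move: KeB lnB Bpop => KeB _ _.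
set S : R := #|diffset A B|%:R; set a : R := #|A|%:R in Adelta A0 *.
set r : R := (rho A)%:R; set N : R := #|G|%:R in Adelta G0 *.
set n : R := #|B|%:R in KeB B0R *.
move=> SD aS energy form.
have S0 : 0 < S by exact: lt_le_trans aS.
have delta0 : 0 <= delta by rewrite -(pmulr_lge0 _ G0) -Adelta ltW.
(* The relative size of the trivial-character term: K a / N = K delta <= K^2 delta as K >= 1. *)
have KaN : K * a / N <= e.
  rewrite Adelta -!mulrA divff ?gt_eqF // mulr1.
  apply: le_trans (_ : e / 4 <= _); last by lra.
  apply: le_trans K2d; rewrite ler_wpM2r // expr2 ler_peMl //; exact: ltW.
(* Of (1 - e)^2 >= 1 - 2e the trivial character takes a further e; squaring what is left and
   cancelling S K a gives the bound. *)
have M2 : (1 - 3 * e) ^+ 2 * (S * a) <= M ^+ 2 * K.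
  have SKa : 0 < S * (K * a) by rewrite !mulr_gt0.
  rewrite -(ler_pM2r SKa).
  have -> : M ^+ 2 * K * (S * (K * a)) = (M * Num.sqrt (S * (K * a))) ^+ 2 * K.
    by rewrite exprMn sqr_sqrtr ?ltW //; ring.
  have -> : (1 - 3 * e) ^+ 2 * (S * a) * (S * (K * a))
      = ((1 - 3 * e) * (S * a)) ^+ 2 * K by ring.
  rewrite ler_pM2r // ler_sqr ?nnegrE; first last.
  - by rewrite mulr_ge0 ?sqrtr_ge0.
  - by rewrite !mulr_ge0 ?ltW //; lra.
  have : S * a * (K * a) / N <= S * a * e by rewrite -mulrA ler_pM2l ?mulr_gt0.
  have : (1 - 2 * e) * (S * a) <= (1 - e) ^+ 2 * (S * a).
    by rewrite ler_pM2r ?mulr_gt0 //; have := sqr_ge0 e; nra.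
  by lra.
(* The diagonal energy term S a n is at most e a^2 n^2, by S <= K a and K <= e n. *)
have Sr : (1 - e) * a ^+ 2 <= S * r.
  have an0 : 0 < n ^+ 2 by rewrite exprn_gt0.
  have nK : K <= e * n by rewrite -ler_pdivrMl // mulrC.
  rewrite -(ler_pM2r an0).
  have : S * (a * n) <= K * a * (a * n) by rewrite ler_pM2r ?mulr_gt0.
  have : K * (a ^+ 2 * n) <= e * n * (a ^+ 2 * n).
    by rewrite ler_pM2r ?mulr_gt0 ?exprn_gt0.
  by move: energy; rewrite exprMn; lra.
have r0 : 0 <= r by rewrite ler0n.
rewrite mulrA ler_pdivrMr //.
apply: (@le_trans _ _ ((1 - 3 * e) ^+ 2 * (1 - e) * a ^+ 3)).
  rewrite ler_pM2r ?exprn_gt0 //.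
  apply: (@le_trans _ _ (1 - 7 * e)); first by lra.
  have := sqr_ge0 e; nra.
(* The uncontrolled size S is eliminated: [Sr] introduces it and [M2] absorbs it. *)
apply: (@le_trans _ _ ((1 - 3 * e) ^+ 2 * a * (S * r))).
  have -> : (1 - 3 * e) ^+ 2 * (1 - e) * a ^+ 3
      = (1 - 3 * e) ^+ 2 * a * ((1 - e) * a ^+ 2) by ring.
  by rewrite ler_wpM2l // mulr_ge0 ?sqr_ge0 ?ltW.
rewrite [leLHS](_ : _ = (1 - 3 * e) ^+ 2 * (S * a) * r); last by ring.
by rewrite [leRHS]mulrAC ler_wpM2r.
Qed.
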